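(* Let $\mathbb{KC}=((G,R),(M,S),I)$ be a Kripke context based on the context $\mathbb{K}=(G,M,I)$. Then the following hold. 1. $\underline{\mathfrak{P}}^{+}(\mathbb{KC}):=(\mathfrak{P}(\mathbb{K}),\sqcup,\sqcap,\neg,\lrcorner,\top,\bot,f_{R},f_{S})$ is a contextual dBao. 2. $\underline{\mathfrak{H}}^{+}(\mathbb{KC}):=(\mathfrak{H}(\mathbb{K}),\sqcup,\sqcap,\neg,\lrcorner,\top,\bot,f_{R}|_{\mathfrak{H}(\mathbb{K})},f_{S}|_{\mathfrak{H}(\mathbb{K})})$ is a pure dBao. It is the largest pure subalgebra of $\underline{\mathfrak{P}}^{+}(\mathbb{KC})$, that is, $\underline{\mathfrak{P}}^{+}(\mathbb{KC})_{p}=\underline{\mathfrak{H}}^{+}(\mathbb{KC})$.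
   Context: **Double Boolean algebras.** A double Boolean algebra (dBa) is an algebra $\mathbf{D}=(D,\sqcup,\sqcap,\neg,\lrcorner,\top,\bot)$ such that, writing $x\vee y:=\neg(\neg x\sqcap\neg y)$ and $x\wedge y:=\lrcorner(\lrcorner x\sqcup\lrcorner y)$, for all $x,y,z\in D$: (1a) $(x\sqcap x)\sqcap y=x\sqcap y$; (1b) $(x\sqcup x)\sqcup y=x\sqcup y$; (2a) $x\sqcap y=y\sqcap x$; (2b) $x\sqcup y=y\sqcup x$; (3a) $x\sqcap(y\sqcap z)=(x\sqcap y)\sqcap z$; (3b) $x\sqcup(y\sqcup z)=(x\sqcup y)\sqcup z$; (4a) $\neg(x\sqcap x)=\neg x$; (4b) $\lrcorner(x\sqcup x)=\lrcorner x$; (5a) $x\sqcap(x\sqcup y)=x\sqcap x$; (5b) $x\sqcup(x\sqcap y)=x\sqcup x$; (6a) $x\sqcap(y\vee z)=(x\sqcap y)\vee(x\sqcap z)$; (6b) $x\sqcup(y\wedge z)=(x\sqcup y)\wedge(x\sqcup z)$; (7a) $x\sqcap(x\vee y)=x\sqcap x$; (7b) $x\sqcup(x\wedge y)=x\sqcup x$; (8a) $\neg\neg(x\sqcap y)=x\sqcap y$; (8b) $\lrcorner\lrcorner(x\sqcup y)=x\sqcup y$; (9a) $x\sqcap\neg x=\bot$; (9b) $x\sqcup\lrcorner x=\top$; (10a) $\neg\bot=\top\sqcap\top$; (10b) $\lrcorner\top=\bot\sqcup\bot$; (11a) $\neg\top=\bot$; (11b) $\lrcorner\bot=\top$; (12)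 $(x\sqcap x)\sqcup(x\sqcap x)=(x\sqcup x)\sqcap(x\sqcup x)$. The quasi-order is: $x\sqsubseteq y$ iff $x\sqcap y=x\sqcap x$ and $x\sqcup y=y\sqcup y$. $\mathbf{D}$ is contextual if $\sqsubseteq$ is a partial order, and pure if for each $x\in D$, $x\sqcap x=x$ or $x\sqcup x=x$. $D_p:=\{x\in D: x\sqcap x=x\text{ or }x\sqcup x=x\}$. **dBao.** A dBa with operators (dBao) is $\mathfrak{O}=(D,\sqcup,\sqcap,\neg,\lrcorner,\top,\bot,\mathbf{I},\mathbf{C})$ where the reduct without $\mathbf{I},\mathbf{C}$ is a dBa and $\mathbf{I},\mathbf{C}:D\to D$ are monotone with respect to $\sqsubseteq$ and satisfy, for all $x,y$: $\mathbf{I}(x\sqcap y)=\mathbf{I}(x)\sqcap\mathbf{I}(y)$, $\mathbf{C}(x\sqcup y)=\mathbf{C}(x)\sqcup\mathbf{C}(y)$, $\mathbf{I}(\neg\bot)=\neg\bot$, $\mathbf{C}(\lrcorner\top)=\lrcorner\top$, $\mathbf{I}(x\sqcap x)=\mathbf{I}(x)$, $\mathbf{C}(x\sqcup x)=\mathbf{C}(x)$. It is contextual (pure) if its underlying dBa is. $\mathfrak{O}_p$ denotes the subalgebra of $\mathfrak{O}$ with universe $D_p$. **Contexts and protoconcepts.** A context is $\mathbb{K}=(G,M,I)$ with $G,M$ sets and $I\subseteq G\times M$. For $A\subseteq G$, $A':=\{m\in M: gIm\text{ for all }g\in A\}$; for $B\subseteq M$, $B':=\{g\in G: gIm\text{ for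 all }m\in B\}$. A pair $(A,B)$ with $A\subseteq G$, $B\subseteq M$ is a protoconcept if $A''=B'$ (equivalently $A'=B''$), and a semiconcept if $A'=B$ or $B'=A$; $\mathfrak{P}(\mathbb{K})$, $\mathfrak{H}(\mathbb{K})$ are the sets of protoconcepts and semiconcepts, and $\mathfrak{H}(\mathbb{K})\subseteq\mathfrak{P}(\mathbb{K})$. Operations on $\mathfrak{P}(\mathbb{K})$: $(A_1,B_1)\sqcap(A_2,B_2):=(A_1\cap A_2,(A_1\cap A_2)')$, $(A_1,B_1)\sqcup(A_2,B_2):=((B_1\cap B_2)',B_1\cap B_2)$, $\neg(A,B):=(G\setminus A,(G\setminus A)')$, $\lrcorner(A,B):=((M\setminus B)',M\setminus B)$, $\top:=(G,\emptyset)$, $\bot:=(\emptyset,M)$. **Kripke contexts.** A Kripke context based on $\mathbb{K}=(G,M,I)$ is $\mathbb{KC}=((G,R),(M,S),I)$ with $R$, $S$ arbitrary binary relations on $G$, $M$. For a binary relation $E$ on $W$ and $A\subseteq W$, $\underline{A}_E:=\{x\in W:\forall y\,(xEy\Rightarrow y\in A)\}$. For $(A,B)\in\mathfrak{P}(\mathbb{K})$, $f_R((A,B)):=(\underline{A}_R,(\underline{A}_R)')$ and $f_S((A,B)):=((\underline{B}_S)',\underline{B}_S)$. *)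

(* Defs.v *)
From mathcomp Require Import all_boot classical_sets.

Set Implicit Arguments.
Unset Strict Implicit.
Unset Printing Implicit Defensive.

Local Open Scope classical_set_scope.

(* An algebra of double Boolean signature is encoded by its universe, a set in
   an ambient type T, and by operations defined on the whole of T. Only their
   values on the universe matter: closure of the universe is part of [is_dba]
   and [is_dbao], and all axioms are relativized to the universe. Thus an
   algebra and its subalgebras share T and the operations, and restricting the
   operations amounts to changing the universe. *)
Record dba_sig (T : Type) := DbaSig {
  universe : set T;
  join : T -> T -> T;
  meet : T -> T -> T;
  neg : T -> T;
  opp : T -> T;
  top : T;
  bot : T }.

Record dbao_sig (T : Type) := DbaoSig {
  dba_reduct :> dba_sig T;
  iop : T -> T;
  cop : T -> T }.

Section Dba.
Variables (T : Type) (D : dba_sig T).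

Local Notation U := (universe D).
Local Notation "x ⊔ y" := (join D x y) (at level 50, left associativity).
Local Notation "x ⊓ y" := (meet D x y) (at level 50, left associativity).
Local Notation "¬ x" := (neg D x) (at level 35, right associativity).
Local Notation "⌟ x" := (opp D x) (at level 35, right associativity).
Local Notation "⊤" := (top D).
Local Notation "⊥" := (bot D).

Definition vee (x y : T) : T := ¬ (¬ x ⊓ ¬ y).
Definition wedge (x y : T) : T := ⌟ (⌟ x ⊔ ⌟ y).

Record dba_closed : Prop := DbaClosed {
  closed_join : forall x y, U x -> U y -> U (x ⊔ y);
  closed_meet : forall x y, U x -> U y -> U (x ⊓ y);
  closed_neg : forall x, U x -> U (¬ x);
  closed_opp : forall x, U x -> U (⌟ x);
  closed_top : U ⊤;
  closed_bot : U ⊥ }.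

Record is_dba : Prop := IsDba {
  dba_is_closed : dba_closed;
  dba1a : forall x y, U x -> U y -> (x ⊓ x) ⊓ y = x ⊓ y;
  dba1b : forall x y, U x -> U y -> (x ⊔ x) ⊔ y = x ⊔ y;
  dba2a : forall x y, U x -> U y -> x ⊓ y = y ⊓ x;
  dba2b : forall x y, U x -> U y -> x ⊔ y = y ⊔ x;
  dba3a : forall x y z, U x -> U y -> U z -> x ⊓ (y ⊓ z) = (x ⊓ y) ⊓ z;
  dba3b : forall x y z, U x -> U y -> U z -> x ⊔ (y ⊔ z) = (x ⊔ y) ⊔ z;
  dba4a : forall x, U x -> ¬ (x ⊓ x) = ¬ x;
  dba4b : forall x, U x -> ⌟ (x ⊔ x) = ⌟ x;
  dba5a : forall x y, U x -> U y -> x ⊓ (x ⊔ y) = x ⊓ x;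
  dba5b : forall x y, U x -> U y -> x ⊔ (x ⊓ y) = x ⊔ x;
  dba6a : forall x y z, U x -> U y -> U z ->
    x ⊓ vee y z = vee (x ⊓ y) (x ⊓ z);
  dba6b : forall x y z, U x -> U y -> U z ->
    x ⊔ wedge y z = wedge (x ⊔ y) (x ⊔ z);
  dba7a : forall x y, U x -> U y -> x ⊓ vee x y = x ⊓ x;
  dba7b : forall x y, U x -> U y -> x ⊔ wedge x y = x ⊔ x;
  dba8a : forall x y, U x -> U y -> ¬ ¬ (x ⊓ y) = x ⊓ y;
  dba8b : forall x y, U x -> U y -> ⌟ ⌟ (x ⊔ y) = x ⊔ y;
  dba9a : forall x, U x -> x ⊓ ¬ x = ⊥;
  dba9b : forall x, U x -> x ⊔ ⌟ x = ⊤;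
  dba10a : ¬ ⊥ = ⊤ ⊓ ⊤;
  dba10b : ⌟ ⊤ = ⊥ ⊔ ⊥;
  dba11a : ¬ ⊤ = ⊥;
  dba11b : ⌟ ⊥ = ⊤;
  dba12 : forall x, U x -> (x ⊓ x) ⊔ (x ⊓ x) = (x ⊔ x) ⊓ (x ⊔ x) }.

Definition sqle (x y : T) : Prop := x ⊓ y = x ⊓ x /\ x ⊔ y = y ⊔ y.

Record contextual : Prop := Contextual {
  sqle_refl : forall x, U x -> sqle x x;
  sqle_trans : forall x y z, U x -> U y -> U z ->
    sqle x y -> sqle y z -> sqle x z;
  sqle_anti : forall x y, U x -> U y -> sqle x y -> sqle y x -> x = y }.

Definition pure : Prop := forall x, U x -> x ⊓ x = x \/ x ⊔ x = x.

Definition pure_universe : set T :=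
  [set x | U x /\ (x ⊓ x = x \/ x ⊔ x = x)].

Definition restrict_dba (V : set T) : dba_sig T :=
  DbaSig V (join D) (meet D) (neg D) (opp D) ⊤ ⊥.

End Dba.

Section Dbao.
Variables (T : Type) (O : dbao_sig T).

Local Notation U := (universe O).
Local Notation "x ⊔ y" := (join O x y) (at level 50, left associativity).
Local Notation "x ⊓ y" := (meet O x y) (at level 50, left associativity).

Record dbao_closed : Prop := DbaoClosed {
  dbao_dba_closed : dba_closed O;
  closed_iop : forall x, U x -> U (iop O x);
  closed_cop : forall x, U x -> U (cop O x) }.

Record is_dbao : Prop := IsDbao {
  dbao_is_dba : is_dba O;
  dbao_is_closed : dbao_closed;
  iop_mono : forall x y, U x -> U y -> sqle O x y -> sqle O (iop O x) (iop O y);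
  cop_mono : forall x y, U x -> U y -> sqle O x y -> sqle O (cop O x) (cop O y);
  iop_meet : forall x y, U x -> U y -> iop O (x ⊓ y) = iop O x ⊓ iop O y;
  cop_join : forall x y, U x -> U y -> cop O (x ⊔ y) = cop O x ⊔ cop O y;
  iop_neg_bot : iop O (neg O (bot O)) = neg O (bot O);
  cop_opp_top : cop O (opp O (top O)) = opp O (top O);
  iop_idem : forall x, U x -> iop O (x ⊓ x) = iop O x;
  cop_idem : forall x, U x -> cop O (x ⊔ x) = cop O x }.

Definition restrict (V : set T) : dbao_sig T :=
  DbaoSig (restrict_dba O V) (iop O) (cop O).

Definition pure_part : dbao_sig T := restrict (pure_universe O).

End Dbao.

Record subalgebra (T : Type) (B A : dbao_sig T) : Prop := Subalgebra {
  subalgebra_sub : universe B `<=` universe A;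
  subalgebra_ops : B = restrict A (universe B);
  subalgebra_closed : dbao_closed B }.

Record context := Context {
  obj : Type;
  attr : Type;
  inc : obj -> attr -> Prop }.

Record kripke_context (K : context) := KripkeContext {
  obj_rel : obj K -> obj K -> Prop;
  attr_rel : attr K -> attr K -> Prop }.

Definition box (W : Type) (E : W -> W -> Prop) (A : set W) : set W :=
  [set x | forall y, E x y -> A y].

Section Concepts.
Variable K : context.

Definition intent (A : set (obj K)) : set (attr K) :=
  [set m | forall g, A g -> inc g m].
Definition extent (B : set (attr K)) : set (obj K) :=
  [set g | forall m, B m -> inc g m].

Definition cpair : Type := set (obj K) * set (attr K).

Definition protoconcepts : set cpair :=
  [set x | extent (intent x.1) = extent x.2].
Definition semiconcepts : set cpair :=
  [set x | intent x.1 = x.2 \/ extent x.2 = x.1].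

Definition cmeet (x y : cpair) : cpair :=
  (x.1 `&` y.1, intent (x.1 `&` y.1)).
Definition cjoin (x y : cpair) : cpair :=
  (extent (x.2 `&` y.2), x.2 `&` y.2).
Definition cneg (x : cpair) : cpair := (~` x.1, intent (~` x.1)).
Definition copp (x : cpair) : cpair := (extent (~` x.2), ~` x.2).
Definition ctop : cpair := (setT, set0).
Definition cbot : cpair := (set0, setT).

Variable KC : kripke_context K.

Definition f_R (x : cpair) : cpair :=
  (box (obj_rel KC) x.1, intent (box (obj_rel KC) x.1)).
Definition f_S (x : cpair) : cpair :=
  (extent (box (attr_rel KC) x.2), box (attr_rel KC) x.2).

Definition protoconcept_algebra : dbao_sig cpair :=
  DbaoSig (DbaSig protoconcepts cjoin cmeet cneg copp ctop cbot) f_R f_S.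
Definition semiconcept_algebra : dbao_sig cpair :=
  DbaoSig (DbaSig semiconcepts cjoin cmeet cneg copp ctop cbot) f_R f_S.

End Concepts.

Arguments protoconcepts : clear implicits.
Arguments semiconcepts : clear implicits.

(* Main.v *)
Require Import Defs.
From mathcomp Require Import all_boot classical_sets.

Set Implicit Arguments.
Unset Strict Implicit.
Unset Printing Implicit Defensive.

Local Open Scope classical_set_scope.

(** The operations [cmeet], [cneg] and [f_R] return pairs (A, A'), and [A] is
    obtained by applying an operation of the power set Boolean algebra of the
    objects (intersection, complement, [box]) to the first components of the
    arguments. Dually [cjoin], [copp] and [f_S] return pairs (B', B) and
    compute in the power set of the attributes. So an identity of double
    Boolean algebras that involves one family only is a Boolean identity
    between first (or second) components. The two families interact only in
    the absorption laws [dba5a], [dba5b] and in [dba12], which rest on the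
    Galois connection between extents and intents: a protoconcept (A, B)
    satisfies A <= A'' = B', B <= A', and A' = B''.

    The quasi-order of protoconcepts is inclusion of the first components
    together with reverse inclusion of the second ones, which is a partial
    order because it sees both components of a pair; it is preserved by [f_R]
    and [f_S] because [box] is monotone.

    As (A, B) meets itself in (A, A') and joins itself in (B', B), the pure
    elements are exactly the semiconcepts. Every operation takes its values
    among the semiconcepts, so they form a subalgebra; the equational and
    monotonicity axioms are inherited by any closed part of the universe. *)

(** * Subalgebras of algebras with operators *)

Section Restriction.
Variables (T : Type) (O : dbao_sig T) (V : set T).

(** Apart from identities between constants, all axioms are universally
    quantified over the universe, and the operations
    are not changed by the restriction; hence closure is the only thing that a
    smaller universe has to satisfy. *)
Lemma is_dbao_restrict :
  is_dbao O -> V `<=` universe O -> dbao_closed (restrict O V) ->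
  is_dbao (restrict O V).
Proof.
move=> [[_ a1 b1 a2 b2 a3 b3 a4 b4 a5 b5 a6 b6 a7 b7 a8 b8 a9 b9 a10 b10 a11 b11
  a12] _ mI mC hI hC eI eC iI iC] sVU clV.
split=> //; last 6 first.
- by move=> x y /sVU Ux /sVU Uy; apply: mI.
- by move=> x y /sVU Ux /sVU Uy; apply: mC.
- by move=> x y /sVU Ux /sVU Uy; apply: hI.
- by move=> x y /sVU Ux /sVU Uy; apply: hC.
- by move=> x /sVU; apply: iI.
- by move=> x /sVU; apply: iC.
split=> //=; first exact: dbao_dba_closed clV.
all: by move=> *; (apply: a1 || apply: b1 || apply: a2 || apply: b2 ||
  apply: a3 || apply: b3 || apply: a4 || apply: b4 || apply: a5 ||
  apply: b5 || apply: a6 || apply: b6 || apply: a7 || apply: b7 ||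
  apply: a8 || apply: b8 || apply: a9 || apply: b9 || apply: a12);
  apply: sVU.
Qed.

End Restriction.

Section Protoconcepts.
Variable K : context.
Implicit Types (A : set (obj K)) (B : set (attr K)) (x y : cpair K).

(** * The Galois connection of a context *)

Lemma intentS A1 A2 : A1 `<=` A2 -> intent A2 `<=` intent A1.
Proof. by move=> sA m A2m g /sA; apply: A2m. Qed.

Lemma extentS B1 B2 : B1 `<=` B2 -> extent B2 `<=` extent B1.
Proof. by move=> sB g B2g m /sB; apply: B2g. Qed.

Lemma sub_extent_intent A : A `<=` extent (intent A).
Proof. by move=> g Ag m; apply. Qed.

Lemma sub_intent_extent B : B `<=` intent (extent B).
Proof. by move=> m Bm g; apply. Qed.

Lemma intentK A : intent (extent (intent A)) = intent A.
Proof.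
apply/seteqP; split; last exact: sub_intent_extent.
exact/intentS/sub_extent_intent.
Qed.

Lemma extentK B : extent (intent (extent B)) = extent B.
Proof.
apply/seteqP; split; last exact: sub_extent_intent.
exact/extentS/sub_intent_extent.
Qed.

Lemma intent_set0 : intent (set0 : set (obj K)) = setT.
Proof. by apply/seteqP; split=> // m _ g. Qed.

Lemma extent_set0 : extent (set0 : set (attr K)) = setT.
Proof. by apply/seteqP; split=> // g _ m. Qed.

(** * Protoconcepts and semiconcepts *)

Lemma protoconcept_intent x :
  protoconcepts K x -> intent x.1 = intent (extent x.2).
Proof. by case: x => A B /= AB; rewrite -AB intentK. Qed.

Lemma protoconcept_sub_extent x : protoconcepts K x -> x.1 `<=` extent x.2.
Proof. by case: x => A B /= <-; apply: sub_extent_intent. Qed.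

Lemma protoconcept_sub_intent x : protoconcepts K x -> x.2 `<=` intent x.1.
Proof.
by move=> /protoconcept_intent ->; apply: sub_intent_extent.
Qed.

Lemma semiconcept_protoconcept : semiconcepts K `<=` protoconcepts K.
Proof.
move=> [A B] [/= AB|/= BA]; first by rewrite /protoconcepts /= AB.
by rewrite /protoconcepts /= -BA extentK.
Qed.

Lemma semiconcept_intent A : semiconcepts K (A, intent A).
Proof. by left. Qed.

Lemma semiconcept_extent B : semiconcepts K (extent B, B).
Proof. by right. Qed.

Lemma cmeetxx x : cmeet x x = (x.1, intent x.1).
Proof. by rewrite /cmeet setIid. Qed.

Lemma cjoinxx x : cjoin x x = (extent x.2, x.2).
Proof. by rewrite /cjoin setIid. Qed.

(** The meet of a pair with itself is (A, A') and its join with itself is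
    (B', B); this identifies the semiconcepts with the pure elements. *)
Lemma semiconceptP x : semiconcepts K x <-> cmeet x x = x \/ cjoin x x = x.
Proof.
rewrite cmeetxx cjoinxx; case: x => A B; rewrite /semiconcepts /=.
by split=> [] [h|h]; [left; rewrite h|right; rewrite h|left; case: h|
  right; case: h].
Qed.

(** A meet is determined by its first component and a join by its second one,
    so each of the two equations in the quasi-order reduces to an inclusion. *)
Lemma csqleP x y :
  cmeet x y = cmeet x x /\ cjoin x y = cjoin y y <->
  x.1 `<=` y.1 /\ y.2 `<=` x.2.
Proof.
rewrite cmeetxx cjoinxx /cmeet /cjoin; split=> [[[+ _] [_ +]]|[]].
  by move=> /setIidPl ? /setIidPr ?.
by move=> /setIidPl -> /setIidPr ->.
Qed.

Variable KC : kripke_context K.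

(** * The box operator of a relation *)

Section Box.
Variables (W : Type) (E : W -> W -> Prop).

Lemma boxS (X Y : set W) : X `<=` Y -> box E X `<=` box E Y.
Proof. by move=> sXY w Xw v /Xw /sXY. Qed.

Lemma boxI (X Y : set W) : box E (X `&` Y) = box E X `&` box E Y.
Proof.
apply/seteqP; split=> [w h|w [hX hY] v Ev]; last by split; [apply: hX|apply: hY].
by split=> v /h [].
Qed.

Lemma boxT : box E setT = setT.
Proof. by apply/seteqP; split. Qed.

End Box.

(** * The algebras of protoconcepts and of semiconcepts *)

(** Every operation returns a pair (A, A') or (B', B) whatever its arguments, so
    nothing has to be known about the elements of [V]. The constants are of this
    form too: the top is (G, {}) = ({}', {}) and the bot is ({}, M) = ({}, {}'). *)
Lemma closed_of_semiconcepts (V : set (cpair K)) :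
  semiconcepts K `<=` V -> dbao_closed (restrict (protoconcept_algebra KC) V).
Proof.
move=> sV.
have VA A : V (A, intent A) by exact/sV/semiconcept_intent.
have VB B : V (extent B, B) by exact/sV/semiconcept_extent.
split=> [|x _|x _]; [|exact: VA|exact: VB].
split=> [x y _ _|x y _ _|x _|x _| |] //=.
- exact: VB.
- exact: VA.
- exact: VA.
- exact: VB.
- by rewrite /ctop -extent_set0; apply: VB.
- by rewrite /cbot -intent_set0; apply: VA.
Qed.

(** The derived operations [vee] and [wedge] are the unions that go with the
    intersections in [cmeet] and [cjoin], by De Morgan. *)
Lemma cveeE x y :
  cneg (cmeet (cneg x) (cneg y)) =
  (x.1 `|` y.1, intent (x.1 `|` y.1)).
Proof. by rewrite /cneg /= setCI !setCK. Qed.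

Lemma cwedgeE x y :
  copp (cjoin (copp x) (copp y)) =
  (extent (x.2 `|` y.2), x.2 `|` y.2).
Proof. by rewrite /copp /= setCI !setCK. Qed.

Lemma protoconcept_is_dba : is_dba (protoconcept_algebra KC).
Proof.
split=> /=.
- exact: dbao_dba_closed (closed_of_semiconcepts semiconcept_protoconcept).
- by move=> x y _ _; rewrite /cmeet /= setIid.
- by move=> x y _ _; rewrite /cjoin /= setIid.
- by move=> x y _ _; rewrite /cmeet setIC.
- by move=> x y _ _; rewrite /cjoin setIC.
- by move=> x y z _ _ _; rewrite /cmeet /= setIA.
- by move=> x y z _ _ _; rewrite /cjoin /= setIA.
- by move=> x _; rewrite /cneg /= setIid.
- by move=> x _; rewrite /copp /= setIid.
- move=> x y Px _; rewrite cmeetxx /cmeet /= (_ : _ `&` _ = x.1) //.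
  apply/setIidPl => g /(protoconcept_sub_extent Px).
  by apply: extentS; apply: subIsetl.
- move=> x y Px _; rewrite cjoinxx /cjoin /= (_ : _ `&` _ = x.2) //.
  apply/setIidPl => m /(protoconcept_sub_intent Px).
  by apply: intentS; apply: subIsetl.
- by move=> x y z _ _ _; rewrite /vee /= !cveeE /cmeet /= setIUr.
- by move=> x y z _ _ _; rewrite /wedge /= !cwedgeE /cjoin /= setIUr.
- move=> x y _ _; rewrite /vee /= cveeE cmeetxx /cmeet /=.
  by rewrite setUC setKU.
- move=> x y _ _; rewrite /wedge /= cwedgeE cjoinxx /cjoin /=.
  by rewrite setUC setKU.
- by move=> x y _ _; rewrite /cneg /= setCK.
- by move=> x y _ _; rewrite /copp /= setCK.
- by move=> x _; rewrite /cmeet /= setICr intent_set0.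
- by move=> x _; rewrite /cjoin /= setICr extent_set0.
- by rewrite cmeetxx /cneg /= setC0.
- by rewrite cjoinxx /copp /= setC0.
- by rewrite /cneg /= setCT intent_set0.
- by rewrite /copp /= setCT extent_set0.
- move=> x Px; rewrite !cmeetxx !cjoinxx /=.
  (* The two sides are (A'', A') and (B', B''). *)
  by rewrite -(protoconcept_intent Px) Px.
Qed.

Lemma protoconcept_is_dbao : is_dbao (protoconcept_algebra KC).
Proof.
split=> /=.
- exact: protoconcept_is_dba.
- exact: closed_of_semiconcepts semiconcept_protoconcept.
- move=> x y _ _ /csqleP [sA _]; apply/csqleP.
  by split; [|apply: intentS]; apply: boxS.
- move=> x y _ _ /csqleP [_ sB]; apply/csqleP.
  by split; [apply: extentS|]; apply: boxS.
- by move=> x y _ _; rewrite /f_R /cmeet /= boxI.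
- by move=> x y _ _; rewrite /f_S /cjoin /= boxI.
- by rewrite /f_R /cneg /= setC0 boxT.
- by rewrite /f_S /copp /= setC0 boxT.
- by move=> x _; rewrite /f_R /= setIid.
- by move=> x _; rewrite /f_S /= setIid.
Qed.

Lemma protoconcept_contextual : contextual (protoconcept_algebra KC).
Proof.
split=> [x _|x y z _ _ _ /csqleP [sA sB] /csqleP [sA' sB']|].
- by split.
- by apply/csqleP; split; [apply: subset_trans sA sA'|apply: subset_trans sB' sB].
- move=> [A B] [A' B'] _ _ /csqleP [/= sA sB] /csqleP [/= sA' sB'].
  by congr pair; apply/seteqP.
Qed.

Lemma semiconcept_closed : dbao_closed (semiconcept_algebra KC).
Proof. exact: (closed_of_semiconcepts (@subset_refl _ _)). Qed.

Lemma semiconcept_is_dbao : is_dbao (semiconcept_algebra KC).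
Proof.
exact: (is_dbao_restrict protoconcept_is_dbao semiconcept_protoconcept
  semiconcept_closed).
Qed.

Lemma semiconcept_subalgebra :
  subalgebra (semiconcept_algebra KC) (protoconcept_algebra KC).
Proof.
split=> //; [exact: semiconcept_protoconcept|exact: semiconcept_closed].
Qed.

(** Idempotence for the meet or the join does not depend on the universe, so
    the elements of a pure [B] are semiconcepts by [semiconceptP]. *)
Lemma pure_subalgebra_semiconcept (B : dbao_sig (cpair K)) :
  subalgebra B (protoconcept_algebra KC) -> pure B ->
  subalgebra B (semiconcept_algebra KC).
Proof.
move=> [_ opsB clB] pureB; split=> // x Bx; apply/semiconceptP.
by move: (pureB x Bx); rewrite opsB.
Qed.

Lemma pure_part_protoconcept :
  pure_part (protoconcept_algebra KC) = semiconcept_algebra KC.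
Proof.
suff e : pure_universe (protoconcept_algebra KC) = semiconcepts K.
  by rewrite /pure_part e.
apply/seteqP; split=> x; first by move=> [_ /semiconceptP].
by move=> Hx; split; [apply: semiconcept_protoconcept|apply/semiconceptP].
Qed.

End Protoconcepts.

Theorem theorem15 (K : context) (KC : kripke_context K) :
  (is_dbao (protoconcept_algebra KC) /\ contextual (protoconcept_algebra KC)) /\
  (is_dbao (semiconcept_algebra KC) /\ pure (semiconcept_algebra KC) /\
   subalgebra (semiconcept_algebra KC) (protoconcept_algebra KC) /\
   (forall B : dbao_sig (cpair K),
      subalgebra B (protoconcept_algebra KC) -> pure B ->
      subalgebra B (semiconcept_algebra KC)) /\
   pure_part (protoconcept_algebra KC) = semiconcept_algebra KC).
Proof.
split.
  by split; [exact: protoconcept_is_dbao|exact: protoconcept_contextual].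
split; first exact: semiconcept_is_dbao.
split; first by move=> x /semiconceptP.
split; first exact: semiconcept_subalgebra.
split; last exact: pure_part_protoconcept.
exact: pure_subalgebra_semiconcept.
Qed.
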